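(* The metric space $\mathbb{H}\times\mathbb{R}^2_3$, with the product metric $d((x,p),(y,q)):=\left(d_{\mathbb{H}}^2(x,y)+\|p-q\|_3^2\right)^{1/2}$, is not a CAT(0) space.
   Context: $\mathbb{H}:=\{(x_1,x_2)\in\mathbb{R}^2\mid x_2>0\}$ is the Poincaré upper half-plane with metric $d_{\mathbb{H}}(x,y):=\operatorname{arcosh}\left(1+\frac{(y_1-x_1)^2+(y_2-x_2)^2}{2x_2y_2}\right)$, where $\operatorname{arcosh}t=\ln(t+\sqrt{t^2-1})$ for $t\ge1$. $\mathbb{R}^2_3$ is the plane $\mathbb{R}^2$ with the norm $\|(s,t)\|_3=(|s|^3+|t|^3)^{1/3}$ and its induced metric. A geodesic in a metric space $(X,d)$ joining $x,y\in X$ is a map $\gamma:[0,1]\to X$ with $\gamma(0)=x$, $\gamma(1)=y$ and $d(\gamma(t),\gamma(t'))=|t-t'|d(x,y)$ for all $t,t'\in[0,1]$; $(X,d)$ is geodesic if any two points are joined by a geodesic. A CAT(0) space is a geodesic space $(X,d)$ such that, for any geodesic $\gamma:[0,1]\to X$, any $z\in X$ and $t\in[0,1]$, $d^2(z,\gamma(t))\le(1-t)d^2(z,\gamma(0))+td^2(z,\gamma(1))-t(1-t)d^2(\gamma(0),\gamma(1))$, where $d^2(x,y)$ means $(d(x,y))^2$. *)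

(* Defs.v *)
From HB Require Import structures.
From mathcomp Require Import all_boot all_order all_algebra.
From mathcomp Require Import ring lra.
From mathcomp Require Import boolp classical_sets reals topology exp.

Set Implicit Arguments.
Unset Strict Implicit.
Unset Printing Implicit Defensive.
Import Order.TTheory GRing.Theory Num.Theory.
Local Open Scope ring_scope.

(* Paths are total functions on R; only their restriction to [0, 1] matters. *)
Definition is_geodesic (R : realType) (X : metricType R) (x y : X)
    (gamma : R -> X) : Prop :=
  [/\ gamma 0 = x, gamma 1 = y &
      forall t t' : R, 0 <= t <= 1 -> 0 <= t' <= 1 ->
        mdist (gamma t) (gamma t') = `|t - t'| * mdist x y].

Definition geodesic_space (R : realType) (X : metricType R) : Prop :=
  forall x y : X, exists gamma : R -> X, is_geodesic x y gamma.

Definition CAT0 (R : realType) (X : metricType R) : Prop :=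
  geodesic_space X /\
  forall (x y : X) (gamma : R -> X), is_geodesic x y gamma ->
  forall (z : X) (t : R), 0 <= t <= 1 ->
    mdist z (gamma t) ^+ 2 <=
      (1 - t) * mdist z (gamma 0) ^+ 2 + t * mdist z (gamma 1) ^+ 2
      - t * (1 - t) * mdist (gamma 0) (gamma 1) ^+ 2.

Section UpperHalfPlane.
Variable R : realType.

Definition arcosh (t : R) : R := ln (t + Num.sqrt (t ^+ 2 - 1)).

Definition upper_half_plane : Type := {x : R * R | 0 < x.2}.
HB.instance Definition _ := Choice.on upper_half_plane.

Implicit Types x y z : upper_half_plane.

Definition hyp_ratio x y : R :=
  1 + (((val y).1 - (val x).1) ^+ 2 + ((val y).2 - (val x).2) ^+ 2) /
      (2 * (val x).2 * (val y).2).

Definition hyp_dist x y : R := arcosh (hyp_ratio x y).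

Let hyp_ratio_ge1 x y : 1 <= hyp_ratio x y.
Proof.
case: x y => [[a b] /= b0] [[c d] /= d0].
rewrite /hyp_ratio/= lerDl divr_ge0//.
  by rewrite addr_ge0// sqr_ge0.
by rewrite !mulr_ge0// ltW.
Qed.

Lemma hyp_distxx x : hyp_dist x x = 0.
Proof.
by rewrite /hyp_dist /arcosh /hyp_ratio !subrr expr0n/= addr0 mul0r addr0
  expr1n subrr sqrtr0 addr0 ln1.
Qed.

Lemma hyp_dist_sym x y : hyp_dist x y = hyp_dist y x.
Proof.
rewrite /hyp_dist /hyp_ratio; congr (arcosh (1 + _ / _)); last by ring.
by congr (_ + _); ring.
Qed.

Let arcosh_arg_ge1 (t : R) : 1 <= t -> 1 <= t + Num.sqrt (t ^+ 2 - 1).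
Proof. by move=> t1; rewrite (le_trans t1)// lerDl sqrtr_ge0. Qed.

Lemma hyp_dist_eq0 x y : hyp_dist x y = 0 -> x = y.
Proof.
rewrite /hyp_dist /arcosh => /eqP; rewrite ln_eq0; last first.
  by rewrite (lt_le_trans ltr01)// arcosh_arg_ge1.
move=> /eqP h.
have : hyp_ratio x y = 1.
  apply/eqP; rewrite eq_le hyp_ratio_ge1 andbT -h.
  by rewrite lerDl sqrtr_ge0.
case: x y {h} => [[a b] /= b0] [[c d] /= d0].
rewrite /hyp_ratio/= => /eqP; rewrite -subr_eq0 addrC addKr.
rewrite mulf_eq0 invr_eq0 [2 * b * d == 0]gt_eqF ?mulr_gt0// orbF.
rewrite paddr_eq0 ?sqr_ge0// !sqrf_eq0 !subr_eq0 => /andP[/eqP ac /eqP bd].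
by apply: val_inj => /=; rewrite ac bd.
Qed.

(* Addition formula for cosh, in terms of A = cosh a and B = cosh b. *)
Let cosh_add_le (A B C : R) : 1 <= A -> 1 <= B -> 1 <= C ->
  A ^+ 2 + B ^+ 2 + C ^+ 2 <= 1 + 2 * A * B * C ->
  C + Num.sqrt (C ^+ 2 - 1) <=
  (A + Num.sqrt (A ^+ 2 - 1)) * (B + Num.sqrt (B ^+ 2 - 1)).
Proof.
move=> A1 B1 C1 gram.
have pos (t : R) : 1 <= t -> 0 <= t ^+ 2 - 1 by move=> ?; nra.
have := sqrtr_ge0 (A ^+ 2 - 1); have := sqr_sqrtr (pos _ A1).
have := sqrtr_ge0 (B ^+ 2 - 1); have := sqr_sqrtr (pos _ B1).
set a := Num.sqrt (A ^+ 2 - 1); set b := Num.sqrt (B ^+ 2 - 1).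
move=> b2 b0 a2 a0.
have ab0 : 0 <= a * b by exact: mulr_ge0.
have CD : C <= A * B + a * b.
  have [|CAB] := leP C (A * B); first by move=> ?; lra.
  rewrite -lerBlDl -ler_sqr ?nnegrE ?subr_ge0 ?(ltW CAB)//.
  rewrite exprMn a2 b2; lra.
have -> : (A + a) * (B + b) = (A * B + a * b) + (A * b + B * a) by ring.
rewrite lerD//.
have E0 : 0 <= A * b + B * a.
  by rewrite addr_ge0// mulr_ge0// (le_trans ler01).
have E2 : (A * b + B * a) ^+ 2 = (A * B + a * b) ^+ 2 - 1.
  have -> : (A * b + B * a) ^+ 2 =
    A ^+ 2 * b ^+ 2 + B ^+ 2 * a ^+ 2 + 2 * A * B * a * b by ring.
  have -> : (A * B + a * b) ^+ 2 =
    A ^+ 2 * B ^+ 2 + a ^+ 2 * b ^+ 2 + 2 * A * B * a * b by ring.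
  rewrite a2 b2; ring.
rewrite -(ger0_norm E0) -sqrtr_sqr E2 ler_wsqrtr// lerD2r.
by rewrite ler_sqr// nnegrE; lra.
Qed.

Lemma hyp_dist_triangle y x z :
  hyp_dist x z <= hyp_dist x y + hyp_dist y z.
Proof.
have gt0 (t : R) : 1 <= t -> 0 < t + Num.sqrt (t ^+ 2 - 1).
  by move=> /arcosh_arg_ge1; exact: lt_le_trans.
rewrite /hyp_dist /arcosh -lnM ?posrE ?gt0//.
rewrite ler_ln ?posrE ?mulr_gt0 ?gt0//.
apply: cosh_add_le => //; rewrite -subr_ge0.
case: x y z => [[x1 x2] /= x0] [[y1 y2] /= y0] [[z1 z2] /= z0].
rewrite /hyp_ratio/=.
(* The Gram determinant of three points of the hyperboloid is a square. *)
pose D : R := y1 * (z1 ^+ 2 + z2 ^+ 2) - z1 * (y1 ^+ 2 + y2 ^+ 2)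
  - x1 * ((z1 ^+ 2 + z2 ^+ 2) - (y1 ^+ 2 + y2 ^+ 2))
  + (x1 ^+ 2 + x2 ^+ 2) * (z1 - y1).
rewrite [leRHS](_ : _ = (D / (2 * x2 * y2 * z2)) ^+ 2) ?sqr_ge0//.
by rewrite /D; field; rewrite !gt_eqF.
Qed.

HB.instance Definition _ := @isMetric.Build R upper_half_plane hyp_dist
  hyp_distxx hyp_dist_eq0 hyp_dist_sym hyp_dist_triangle.

Lemma mdist_upper_half_planeE x y : mdist x y = hyp_dist x y.
Proof. by []. Qed.

End UpperHalfPlane.

Section Plane3.
Variable R : realType.

Definition norm3 (p : R * R) : R := (`|p.1| ^+ 3 + `|p.2| ^+ 3) `^ (3^-1).

(* An alias of R * R, to be endowed with the metric induced by norm3 instead of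
   the default (sup) one. *)
Definition plane3 : Type := (R * R)%type.
HB.instance Definition _ := Choice.on plane3.

Definition dist3 (p q : plane3) : R := norm3 ((p : R * R) - (q : R * R)).

Let norm3_ge0 p : 0 <= norm3 p. Proof. exact: powR_ge0. Qed.

Lemma norm3X p : norm3 p ^+ 3 = `|p.1| ^+ 3 + `|p.2| ^+ 3.
Proof.
rewrite -powR_mulrn ?norm3_ge0// -powRrM mulVf ?pnatr_eq0// powRr1//.
by rewrite addr_ge0// exprn_ge0.
Qed.

Lemma norm3_eq0 p : norm3 p = 0 -> p = 0.
Proof.
move=> p0; have := norm3X p; rewrite p0 expr0n/= => /esym/eqP.
rewrite paddr_eq0 ?exprn_ge0// !expf_eq0/= !normr_eq0.
by case: p {p0} => [a b] /= /andP[/eqP -> /eqP ->].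
Qed.

Let cube_convex (l m u v : R) : 0 <= l -> 0 <= m -> l + m = 1 ->
  0 <= u -> 0 <= v -> (l * u + m * v) ^+ 3 <= l * u ^+ 3 + m * v ^+ 3.
Proof.
move=> l0 m0 lm1 u0 v0; have lm : m = 1 - l by lra.
rewrite -subr_ge0 [leRHS](_ : _ =
  l * m * (u - v) ^+ 2 * (u + l * u + v + m * v)); last by rewrite lm; ring.
apply: mulr_ge0; first by apply: mulr_ge0; [exact: mulr_ge0 | exact: sqr_ge0].
by have := mulr_ge0 l0 u0; have := mulr_ge0 m0 v0; lra.
Qed.

Lemma norm3_triangle p q : norm3 (p + q) <= norm3 p + norm3 q.
Proof.
have [/norm3_eq0 ->|p0] := eqVneq (norm3 p) 0.
  by rewrite add0r lerDr norm3_ge0.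
have [/norm3_eq0 ->|q0] := eqVneq (norm3 q) 0.
  by rewrite addr0 lerDl norm3_ge0.
have {}p0 : 0 < norm3 p by rewrite lt_neqAle eq_sym p0 norm3_ge0.
have {}q0 : 0 < norm3 q by rewrite lt_neqAle eq_sym q0 norm3_ge0.
have pX := norm3X p; have qX := norm3X q.
set a := norm3 p in p0 pX *; set b := norm3 q in q0 qX *.
have ab0 : 0 < a + b by exact: addr_gt0.
rewrite -(@ler_pXn2r _ 3)// ?nnegrE ?norm3_ge0// ?(ltW ab0)// norm3X.
have key (s t : R) : `|s + t| ^+ 3 <=
    (a + b) ^+ 2 * (`|s| ^+ 3 / a ^+ 2 + `|t| ^+ 3 / b ^+ 2).
  apply: (@le_trans _ _ ((`|s| + `|t|) ^+ 3)).
    by rewrite lerXn2r ?nnegrE ?addr_ge0// ler_normD.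
  have := @cube_convex (a / (a + b)) (b / (a + b)) (`|s| / a) (`|t| / b).
  rewrite !divr_ge0 ?(ltW p0) ?(ltW q0) ?(ltW ab0)//.
  rewrite -mulrDl divff ?gt_eqF// => /(_ isT isT erefl isT isT).
  rewrite [X in X ^+ 3](_ : _ = (`|s| + `|t|) / (a + b)); last first.
    by field; rewrite !gt_eqF.
  rewrite expr_div_n ler_pdivrMr ?exprn_gt0// => /le_trans; apply.
  by rewrite le_eqVlt; apply/orP; left; apply/eqP; field; rewrite !gt_eqF.
apply: (le_trans (lerD (key p.1 q.1) (key p.2 q.2))).
rewrite -mulrDr addrACA -!mulrDl -pX -qX.
by rewrite le_eqVlt; apply/orP; left; apply/eqP; field; rewrite !gt_eqF.
Qed.

Lemma dist3xx p : dist3 p p = 0.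
Proof.
by rewrite /dist3 subrr /norm3/= normr0 expr0n/= addr0 powR0// invr_eq0 pnatr_eq0.
Qed.

Lemma dist3_eq0 p q : dist3 p q = 0 -> p = q.
Proof. by move=> /norm3_eq0 /eqP; rewrite subr_eq0 => /eqP. Qed.

Lemma dist3_sym p q : dist3 p q = dist3 q p.
Proof. by rewrite /dist3 /norm3 /= distrC [in X in _ + X]distrC. Qed.

Lemma dist3_triangle q p r : dist3 p r <= dist3 p q + dist3 q r.
Proof.
rewrite /dist3; apply: le_trans (norm3_triangle _ _).
by rewrite addrA subrK.
Qed.

HB.instance Definition _ := @isMetric.Build R plane3 dist3
  dist3xx dist3_eq0 dist3_sym dist3_triangle.

Lemma mdist_plane3E (p q : plane3) : mdist p q = dist3 p q.
Proof. by []. Qed.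

End Plane3.

Section L2Product.
Variables (R : realType) (X Y : metricType R).

(* An alias of X * Y, to be endowed with the l2 product metric instead of the
   default (sup) one. *)
Definition l2prod : Type := (X * Y)%type.
HB.instance Definition _ := Choice.on l2prod.

Definition l2dist (u v : l2prod) : R :=
  Num.sqrt (mdist u.1 v.1 ^+ 2 + mdist u.2 v.2 ^+ 2).

Lemma l2distxx u : l2dist u u = 0.
Proof. by rewrite /l2dist !mdistxx expr0n/= addr0 sqrtr0. Qed.

Lemma l2dist_eq0 u v : l2dist u v = 0 -> u = v.
Proof.
move=> /eqP; rewrite sqrtr_eq0 => uv.
have /eqP : mdist u.1 v.1 ^+ 2 + mdist u.2 v.2 ^+ 2 = 0.
  by apply/eqP; rewrite eq_le uv addr_ge0// sqr_ge0.
rewrite paddr_eq0 ?sqr_ge0// !sqrf_eq0 => /andP[/eqP + /eqP].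
case: u v {uv} => [a b] [c d] /=.
by move=> /mdist_positivity -> /mdist_positivity ->.
Qed.

Lemma l2dist_sym u v : l2dist u v = l2dist v u.
Proof. by rewrite /l2dist metric_sym [mdist u.2 _]metric_sym. Qed.

Let sqrt_minkowski (a b c d : R) :
  Num.sqrt ((a + b) ^+ 2 + (c + d) ^+ 2) <=
  Num.sqrt (a ^+ 2 + c ^+ 2) + Num.sqrt (b ^+ 2 + d ^+ 2).
Proof.
have pos (s t : R) : 0 <= s ^+ 2 + t ^+ 2 by rewrite addr_ge0// sqr_ge0.
rewrite -ler_sqr ?nnegrE ?addr_ge0 ?sqrtr_ge0//.
rewrite [leRHS]sqrrD !sqr_sqrtr// -sqrtrM//.
suff : a * b + c * d <=
    Num.sqrt ((a ^+ 2 + c ^+ 2) * (b ^+ 2 + d ^+ 2)) by lra.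
apply: (le_trans (ler_norm _)); rewrite -sqrtr_sqr ler_wsqrtr//.
rewrite -subr_ge0 [leRHS](_ : _ = (a * d - b * c) ^+ 2) ?sqr_ge0//.
by ring.
Qed.

Lemma l2dist_triangle v u w : l2dist u w <= l2dist u v + l2dist v w.
Proof.
rewrite /l2dist; apply: le_trans (sqrt_minkowski _ _ _ _).
by rewrite ler_wsqrtr// lerD// ler_sqr ?nnegrE ?addr_ge0 ?mdist_ge0//
  metric_triangle.
Qed.

HB.instance Definition _ := @isMetric.Build R l2prod l2dist
  l2distxx l2dist_eq0 l2dist_sym l2dist_triangle.

Lemma mdist_l2prodE (u v : l2prod) : mdist u v = l2dist u v.
Proof. by []. Qed.

End L2Product.

(* Main.v *)
Require Import Defs.
From mathcomp Require Import all_boot all_order all_algebra.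
From mathcomp Require Import reals topology.
From mathcomp Require Import exp ring lra.

Set Implicit Arguments.
Unset Strict Implicit.
Unset Printing Implicit Defensive.
Import Order.TTheory GRing.Theory Num.Theory.
Local Open Scope ring_scope.

(** The CAT(0) inequality at the midpoint of a segment of a normed plane is half
    of the parallelogram law, [|m|^2 + |d|^2 <= (|m+d|^2 + |m-d|^2) / 2], and the norm
    [norm3], not being Euclidean, violates it for the vectors [m = (1, 0)] and
    [d = (0, 1)]: the left-hand side is [2], the right-hand side is [2^(2/3)].
    To transport this to the product, keep the hyperbolic coordinate constant:
    a slice [{x} * plane3] is isometrically embedded ([mdist_slice]), so the
    vertical segment from [m + d = (1, 1)] to [m - d = (1, -1)] in such a slice
    is a geodesic of the product ([is_geodesic_vseg]), and the inequality fails
    for it at [t = 1/2] with [z] the origin of the slice. *)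

Section Slice.
Variables (R : realType) (X : metricType R).
Implicit Types (x : X) (p q : plane3 R) (s : R).

Lemma mdist_slice x p q :
  mdist ((x, p) : l2prod X (plane3 R)) ((x, q) : l2prod X (plane3 R)) =
  dist3 p q.
Proof.
rewrite mdist_l2prodE /l2dist /= mdistxx expr0n/= add0r sqrtr_sqr.
by rewrite ger0_norm ?mdist_ge0.
Qed.

Lemma norm3_eq_cube p s : 0 <= s -> `|p.1| ^+ 3 + `|p.2| ^+ 3 = s ^+ 3 ->
  norm3 p = s.
Proof.
move=> s0 ps; apply/eqP; rewrite -(@eqrXn2 _ 3) ?norm3X ?ps//.
exact: powR_ge0.
Qed.

Lemma norm3_fst s : norm3 (s, 0) = `|s|.
Proof. by apply: norm3_eq_cube => //=; rewrite normr0 expr0n/= addr0. Qed.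

Lemma norm3_snd s : norm3 (0, s) = `|s|.
Proof. by apply: norm3_eq_cube => //=; rewrite normr0 expr0n/= add0r. Qed.

(** The segment from [(1, 1)] to [(1, -1)] in the slice over [x]. *)
Definition vseg x : R -> l2prod X (plane3 R) := fun t => (x, (1, 1 - 2 * t)).

Lemma mdist_vseg x (t t' : R) : mdist (vseg x t) (vseg x t') = `|t - t'| * 2.
Proof.
rewrite mdist_slice /dist3.
have -> : ((1, 1 - 2 * t) : R * R) - (1, 1 - 2 * t') = (0, (t' - t) * 2).
  by congr pair => /=; ring.
by rewrite norm3_snd normrM distrC [`|2|]ger0_norm.
Qed.

Lemma is_geodesic_vseg x : is_geodesic (vseg x 0) (vseg x 1) (vseg x).
Proof.
split=> // t t' _ _.
by rewrite !mdist_vseg sub0r normrN1 mul1r.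
Qed.

(** Only one slice is needed, so the first factor may be any nonempty metric
    space. *)
Lemma not_CAT0_l2prod_plane3 x : ~ CAT0 (l2prod X (plane3 R)).
Proof.
case=> _ /(_ _ _ _ (is_geodesic_vseg x) (x, (0, 0)) 2^-1) cat0.
have {cat0} := cat0 ltac:(lra); rewrite mdist_vseg !mdist_slice /dist3.
have sub0E (a b : R) : ((0, 0) : R * R) - (a, b) = (- a, - b).
  by congr pair => /=; ring.
rewrite !sub0E.
have -> : - (1 - 2 * 2^-1) = 0 :> R by field.
have -> : - (1 - 2 * 0) = -1 :> R by ring.
have -> : - (1 - 2 * 1) = 1 :> R by ring.
rewrite norm3_fst sub0r normrN1.
have -> : norm3 (-1, 1) = norm3 (-1, -1) :> R.
  by rewrite /norm3/= normrN1 normr1.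
(* Writing [a] for the norm of [(1, 1)], what remains is [2 <= a ^+ 2], which
   is incompatible with [a ^+ 3 = 2]. *)
have := norm3X (-1, -1) : _ = _ :> R; rewrite /= normrN1 expr1n.
set a := norm3 _ => a3 a2.
have {}a2 : 2 <= a ^+ 2 by lra.
have : (2 : R) ^+ 3 <= (a ^+ 2) ^+ 3 by rewrite lerXn2r ?nnegrE ?sqr_ge0.
by rewrite -exprM mulnC exprM a3; lra.
Qed.

End Slice.

Theorem corollary4p2 (R : realType) :
  ~ CAT0 (l2prod (upper_half_plane R) (plane3 R)).
Proof.
have i_gt0 : 0 < ((0, 1) : R * R).2 by exact: ltr01.
pose i : upper_half_plane R := exist _ (0, 1) i_gt0.
exact: (not_CAT0_l2prod_plane3 i).
Qed.
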